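(* Let $(\mu,\nu),(\mu',\nu')\in\mathcal{P}(\mathsf{X})\times\mathcal{P}(\mathsf{Y})$ be such that the associated entropic optimal transport problems $\mathcal{C}_1(\mu,\nu)$ and $\mathcal{C}_1(\mu',\nu')$ are finite. Let $\pi\in\Pi(\mu,\nu)$ and $\pi'\in\Pi(\mu',\nu')$ be the respective optimizers, with potentials $(\varphi,\psi)$ and $(\varphi',\psi')$, i.e. $d\pi=e^{\varphi\oplus\psi-c}d(\mu\otimes\nu)$ and $d\pi'=e^{\varphi'\oplus\psi'-c}d(\mu'\otimes\nu')$. Set $$C_1:=\inf_{\alpha>0}\frac{2}{\alpha}\Big(\frac32+\log\int e^{\alpha|\varphi'-\varphi|}d\mu\Big),\qquad C_2:=\inf_{\alpha>0}\frac{2}{\alpha}\Big(\frac32+\log\int e^{\alpha|\psi'-\psi|}d\nu\Big).$$ Then $$H(\pi'|\pi)+H(\pi|\pi')\le C_1\sqrt{H(\mu'|\mu)}+(1+C_1/2)H(\mu'|\mu)+H(\mu|\mu')+C_2\sqrt{H(\nu'|\nu)}+(1+C_2/2)H(\nu'|\nu)+H(\nu|\nu').$$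
   Context: $\mathsf{X},\mathsf{Y}$ are Polish spaces, $c:\mathsf{X}\times\mathsf{Y}\to\mathbb{R}$ is measurable with $e^{-c}\in L^1(\mu\otimes\nu)$ (and likewise for $\mu'\otimes\nu'$). For marginals $(\mu,\nu)$, the entropic optimal transport problem is $\mathcal{C}_1(\mu,\nu):=\inf_{\pi\in\Pi(\mu,\nu)}\int c\,d\pi+H(\pi|\mu\otimes\nu)$, where $\Pi(\mu,\nu)$ is the set of couplings of $\mu,\nu$ and $H(\rho|\sigma)=\int\log\frac{d\rho}{d\sigma}d\rho$ if $\rho\ll\sigma$, $+\infty$ otherwise. When finite, it has a unique minimizer $\pi$, and $d\pi=e^{\varphi\oplus\psi-c}d(\mu\otimes\nu)$ for measurable ''potentials'' $\varphi:\mathsf{X}\to\mathbb{R}$, $\psi:\mathsf{Y}\to\mathbb{R}$, where $(\varphi\oplus\psi)(x,y)=\varphi(x)+\psi(y)$. Conventions: the right-hand side is interpreted in $[0,\infty]$. *)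

(* Defs.v *)
From mathcomp Require Import all_boot all_order all_algebra.
From mathcomp Require Import all_classical all_reals all_analysis.

Set Implicit Arguments.
Unset Strict Implicit.
Unset Printing Implicit Defensive.

Import Order.TTheory GRing.Theory Num.Theory.
Local Open Scope classical_set_scope.
Local Open Scope ring_scope.

Definition polish_borel (R : realType) (d : measure_display)
    (T : measurableType d) : Prop :=
  exists dist : T -> T -> R,
    (forall x y, 0 <= dist x y) /\
        (forall x y, dist x y = 0 <-> x = y) /\
        (forall x y, dist x y = dist y x) /\
        (forall x y z, dist x z <= dist x y + dist y z) /\
        (forall u : nat -> T,
            (forall e, 0 < e -> exists N, forall m n, (N <= m)%N -> (N <= n)%N ->
                 dist (u m) (u n) < e) ->
            exists x, forall e, 0 < e -> exists N, forall n, (N <= n)%N ->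
                 dist (u n) x < e) /\
        (exists D : set T, countable D /\
            forall x e, 0 < e -> exists2 y, D y & dist x y < e) /\
        (forall A : set T, measurable A <->
            <<s [set U : set T | forall x, U x ->
                    exists2 r, 0 < r & [set y | dist x y < r] `<=` U] >> A).

Definition prodP (R : realType) (d1 d2 : measure_display)
    (X : measurableType d1) (Y : measurableType d2)
    (mu : probability X R) (nu : probability Y R) : probability (X * Y)%type R :=
  (mu \x nu)%E.

Local Open Scope charge_scope.
Definition relent (R : realType) (d : measure_display) (T : measurableType d)
    (rho sigma : probability T R) : \bar R :=
  if pselect (rho `<< sigma) then
    (\int[rho]_x lne (('d (charge_of_finite_measure rho) '/d sigma) x))%E
  else +oo%E.

Definition is_coupling (R : realType) (d1 d2 : measure_display)
    (X : measurableType d1) (Y : measurableType d2)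
    (mu : probability X R) (nu : probability Y R)
    (pi : probability (X * Y)%type R) : Prop :=
  (forall A : set X, measurable A -> pi (A `*` setT) = mu A) /\
  (forall B : set Y, measurable B -> pi (setT `*` B) = nu B).

(* Objective  int c d pi + H(pi | mu (x) nu)  (set to +oo when the entropy
   is infinite, so that no +oo - oo ambiguity arises). *)
Definition eot_obj (R : realType) (d1 d2 : measure_display)
    (X : measurableType d1) (Y : measurableType d2) (c : X * Y -> R)
    (mu : probability X R) (nu : probability Y R)
    (pi : probability (X * Y)%type R) : \bar R :=
  if relent pi (prodP mu nu) == +oo%E then +oo%E
  else (\int[pi]_z (c z)%:E + relent pi (prodP mu nu))%E.

Definition eot (R : realType) (d1 d2 : measure_display)
    (X : measurableType d1) (Y : measurableType d2) (c : X * Y -> R)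
    (mu : probability X R) (nu : probability Y R) : \bar R :=
  ereal_inf [set eot_obj c mu nu pi | pi in is_coupling mu nu].

Definition Cconst (R : realType) (d : measure_display) (T : measurableType d)
    (mu : probability T R) (f : T -> R) : \bar R :=
  ereal_inf [set ((2 / a)%:E * ((3 / 2)%:E +
                   lne (\int[mu]_x (expR (a * `|f x|))%:E)))%E
            | a in [set a : R | 0 < a]].

(* Main.v *)
(* Write f = phi' - phi, g = psi' - psi, r = dmu'/dmu, s = dnu'/dnu and
   z = dpi'/dpi.  Then ln z = F (+) G with F = f + ln r and G = g + ln s, and
   H(pi'|pi) + H(pi|pi') = \int (z - 1) ln z dpi.  Truncating F and G at level k
   by an odd nondecreasing clamp keeps the integrand nonnegative, so by Fatou the
   left-hand side is at most the lower limit of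
   \int clamp_k F d(mu' - mu) + \int clamp_k G d(nu' - nu); no integrability of
   the potentials is required.  The first integral vanishes if mu = mu', and in
   general is at most \int |f| |r - 1| dmu + H(mu'|mu) + H(mu|mu'), where the
   weighted Pinsker inequality of Bolley and Villani bounds the first term by
   C1 (sqrt H(mu'|mu) + H(mu'|mu) / 2). *)

Require Import Defs.
From mathcomp Require Import all_boot all_order all_algebra.
From mathcomp Require Import all_classical all_reals all_analysis.
From mathcomp Require Import measurable_realfun.
From mathcomp Require Import ring lra.
Import Order.TTheory GRing.Theory Num.Theory.
Import numFieldNormedType.Exports.
Local Open Scope classical_set_scope.
Local Open Scope ring_scope.

(** * Elementary inequalities for the logarithm, the exponential and the entropy function *)

Section real_inequalities.
Context {R : realType}.
Implicit Types (f df : R -> R) (a b x y u r s p phi K c : R).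

Lemma ge0_is_derive_le f df a b : a <= b ->
  (forall x, a <= x <= b -> is_derive x 1 f (df x)) ->
  (forall x, a <= x <= b -> 0 <= df x) -> f a <= f b.
Proof.
move=> ab fdf df0; apply: (@ger0_derive1_ndecr _ f a b) => //.
- move=> x /[!in_itv]/= /andP[ax xb].
  by have [] := fdf x; rewrite ?(ltW ax) ?(ltW xb).
- move=> x /[!in_itv]/= /andP[ax xb].
  have axb : a <= x <= b by rewrite (ltW ax) (ltW xb).
  by rewrite derive1E (@derive_val _ _ _ _ _ _ _ (fdf x axb)) df0.
- apply: derivable_within_continuous => x /[!in_itv]/= axb.
  by have [] := fdf x axb.
Qed.

Lemma ln_ge_1BV x : 0 < x -> 1 - x^-1 <= ln x.
Proof.
move=> x0; have xV0 : 0 < x^-1 by rewrite invr_gt0.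
have := @le_ln1Dx R (x^-1 - 1); rewrite addrCA subrr addr0 lnV ?posrE//.
by move=> /(_ _); lra.
Qed.

Lemma ln_le_B1 x : 0 < x -> ln x <= x - 1.
Proof.
move=> x0; have := @le_ln1Dx R (x - 1); rewrite addrCA subrr addr0.
by apply; lra.
Qed.

Lemma ln_le_half x : 0 < x -> ln x <= x / 2.
Proof.
move=> x0; have x20 : 0 < x / 2 by lra.
have := ln_le_B1 _ x20; rewrite ln_div ?posrE//.
have := @ln_le_B1 2 ltac:(lra); lra.
Qed.

(** Built from operations on functions so that the derivative rules apply to it directly; the
    derivative is (y - c)^2 / (y (y + c)^2). *)
Let pade c : R -> R := @ln R + (4 * c) *: (fun y => ((id + cst c) y)^-1).

Let is_derive_pade c y : 0 < y -> 0 < c ->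
  is_derive y 1 (pade c) (y^-1 + 4 * c * (- (y + c) ^- 2)).
Proof.
move=> y0 c0; have h : is_derive y 1 (id + cst c : R -> R) (1 + 0).
  exact: is_deriveD.
have h2 : is_derive y 1 (fun y : R => ((id + cst c) y)^-1)
    (- (id + cst c) y ^- 2 *: (1 + 0)).
  by apply: is_deriveV; rewrite !fctE gt_eqF//; lra.
apply: is_derive_eq (is_deriveD (is_derive1_ln y0) (is_deriveZ (4 * c) h2)) _.
by rewrite /GRing.scale/= !fctE/= addr0 mulr1.
Qed.

(** [pade c] has a perfect square in the numerator of its derivative, hence is nondecreasing;
    compare its values at 1 and [x]. The bound touches [ln] at 1, and [c] is a free second point of
    tangency of the derivative. *)
Lemma ln_pade c x : 0 < c -> 1 <= x ->
  4 * c * (x - 1) / ((1 + c) * (x + c)) <= ln x.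
Proof.
move=> c0 x1.
have padeE y : pade c y = ln y + 4 * c / (y + c) by [].
have h1 y : 1 <= y <= x -> is_derive y 1 (pade c) (y^-1 + 4 * c * (- (y + c) ^- 2)).
  by move=> /andP[y1 _]; apply: is_derive_pade => //; exact: lt_le_trans y1.
have h2 y : 1 <= y <= x -> 0 <= y^-1 + 4 * c * - (y + c) ^- 2.
  move=> /andP[y1 _]; have y0 : 0 < y by exact: lt_le_trans y1.
  have -> : y^-1 + 4 * c * - (y + c) ^- 2 = (y - c) ^+ 2 / (y * (y + c) ^+ 2).
    by field; apply/andP; split; apply/negP => /eqP; lra.
  by rewrite divr_ge0 ?sqr_ge0// mulr_ge0 ?sqr_ge0// ltW.
have := ge0_is_derive_le _ _ _ _ x1 h1 h2; rewrite !padeE ln1.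
have -> : 4 * c * (x - 1) / ((1 + c) * (x + c)) =
    4 * c / (1 + c) - 4 * c / (x + c).
  by field; apply/andP; split; apply/negP => /eqP; lra.
by rewrite add0r -lerBlDr.
Qed.

(* 5 = (5/4)^3 (4/3)^2 (6/5)^2 *)
Lemma ln5_ge : 8 / 5 <= ln 5 :> R.
Proof.
have a0 : 0 < 5 / 4 :> R by lra.
have b0 : 0 < 4 / 3 :> R by lra.
have c0 : 0 < 6 / 5 :> R by lra.
have -> : ln 5 = ln (5 / 4) *+ 3 + ln (4 / 3) *+ 2 + ln (6 / 5) *+ 2 :> R.
  rewrite -!lnXn// -!lnM ?posrE ?mulr_gt0 ?exprn_gt0//.
  by congr ln; field.
have h1 := @ln_pade 1 (5/4) ltac:(lra) ltac:(lra).
have h2 := @ln_pade 1 (4/3) ltac:(lra) ltac:(lra).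
have h3 := @ln_pade 1 (6/5) ltac:(lra) ltac:(lra).
have e1 : 4 * 1 * (5 / 4 - 1) / ((1 + 1) * (5 / 4 + 1)) = 2 / 9 :> R by field.
have e2 : 4 * 1 * (4 / 3 - 1) / ((1 + 1) * (4 / 3 + 1)) = 2 / 7 :> R by field.
have e3 : 4 * 1 * (6 / 5 - 1) / ((1 + 1) * (6 / 5 + 1)) = 2 / 11 :> R by field.
rewrite {}e1 in h1; rewrite {}e2 in h2; rewrite {}e3 in h3.
rewrite -![ln _ *+ _]mulr_natr.
lra.
Qed.

(* As [ln 0 = 0], the value at [0] is the right one, namely [1]. *)
Definition entfun r := r * ln r - r + 1.

Lemma entfun_ge0 r : 0 <= r -> 0 <= entfun r.
Proof.
rewrite le_eqVlt => /predU1P[<-|r0]; first by rewrite /entfun mul0r; lra.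
have := ln_ge_1BV _ r0; rewrite -(ler_pM2l r0) mulrBr mulfV ?gt_eqF//.
rewrite /entfun; lra.
Qed.

Let quad : R -> R := (4 : R) *: @ln R - id + (3 : R) *: (fun y => (id y)^-1).

Let is_derive_quad y : 0 < y ->
  is_derive y 1 quad (- ((y - 1) * (y - 3) / y ^+ 2)).
Proof.
move=> y0; have yn0 : y != 0 by rewrite gt_eqF.
have h : is_derive y 1 (fun y : R => (id y)^-1) (- (id y) ^- 2 *: 1).
  exact: is_deriveV.
apply: is_derive_eq (is_deriveD (is_deriveB (is_deriveZ 4 (is_derive1_ln y0))
  (is_derive_id y 1)) (is_deriveZ 3 h)) _.
by rewrite /GRing.scale/= mulr1; field.
Qed.

(** Dividing the difference of the two sides by [r] reduces the claim to [2 <= quad r]. The function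
    [quad] decreases up to 1, increases up to 3 and decreases afterwards. Since [quad 1 = 2], only
    [2 <= quad 5] is left, which is exactly [8 / 5 <= ln 5]. *)
Lemma sqr_le_entfun r : 0 < r -> r <= 5 -> (r - 1) ^+ 2 <= 4 * entfun r.
Proof.
move=> r0 r5.
have quadE y : quad y = 4 * ln y - y + 3 * y^-1 by [].
have dquad a b : 0 < a -> forall y, a <= y <= b ->
    is_derive y 1 quad (- ((y - 1) * (y - 3) / y ^+ 2)).
  by move=> a0 y /andP[ay _]; apply: is_derive_quad; exact: lt_le_trans ay.
have dNquad a b : 0 < a -> forall y, a <= y <= b ->
    is_derive y 1 (- quad) ((y - 1) * (y - 3) / y ^+ 2).
  move=> a0 y ayb; have := is_deriveN (dquad _ _ a0 _ ayb).
  by rewrite opprK.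
suff : 2 <= quad r.
  rewrite quadE /entfun -(ler_pM2l r0) => h.
  have : r * (4 * ln r - r + 3 / r) = 4 * (r * ln r) - r ^+ 2 + 3.
    by field; rewrite gt_eqF.
  nra.
have quad1 : quad 1 = 2 by rewrite quadE ln1 invr1; lra.
have [r1|r1] := leP r 1.
  rewrite -quad1 -lerN2; apply: (ge0_is_derive_le _ _ _ _ r1 (dNquad _ _ r0)).
  move=> y /andP[ry y1]; rewrite divr_ge0 ?sqr_ge0//; nra.
have [r3|r3] := leP r 3.
  rewrite -quad1; apply: (ge0_is_derive_le _ _ _ _ (ltW r1) (dquad _ _ ltr01)).
  move=> y /andP[ry y1]; rewrite -mulNr divr_ge0 ?sqr_ge0//; nra.
apply: (@le_trans _ _ (quad 5)); first by rewrite quadE; have := ln5_ge; lra.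
rewrite -lerN2; apply: (ge0_is_derive_le _ _ _ _ r5 (dNquad _ _ r0)).
move=> y /andP[ry y1]; rewrite divr_ge0 ?sqr_ge0//; nra.
Qed.

(** From ln r = ln 5 + ln (r / 5) >= 8/5 + 1 - 5/r, the entropy is at least 8r/5 - 4, which
    dominates r - 1 exactly from r = 5 on. *)
Lemma sub1_le_entfun r : 5 <= r -> r - 1 <= entfun r.
Proof.
move=> r5; have r0 : 0 < r by lra.
have := @ln_ge_1BV (r / 5) ltac:(lra); rewrite ln_div ?posrE// => h.
have : r * (8 / 5 + 1 - (r / 5)^-1) <= r * ln r.
  by rewrite ler_pM2l//; have := ln5_ge; lra.
have -> : r * (8 / 5 + 1 - (r / 5)^-1) = r * (8 / 5 + 1) - 5.
  by field; rewrite gt_eqF.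
rewrite /entfun; lra.
Qed.

(** Replacing ln (u + 1) by ln u costs at least 1 after multiplication by u + 1. What remains is 3
    (u - 1) <= (u + 3) ln u, the case c = 3 of [ln_pade]. *)
Lemma mul_ln_le_entfun u : 4 <= u -> u * ln u <= 3 / 2 * entfun (u + 1).
Proof.
move=> u4; have u0 : 0 < u by lra.
have h1 : 1 <= (u + 1) * (ln (u + 1) - ln u).
  rewrite -ln_div ?posrE//; last by lra.
  have u10 : 0 < u + 1 by lra.
  have := @ln_ge_1BV ((u + 1) / u) ltac:(by rewrite divr_gt0).
  move=> h; apply: le_trans (ler_wpM2l (ltW u10) h).
  rewrite le_eqVlt; apply/orP; left; apply/eqP.
  by field; apply/andP; split; apply/negP => /eqP; lra.
have h2 : 3 * (u - 1) <= (u + 3) * ln u.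
  have := @ln_pade 3 u ltac:(lra) ltac:(lra).
  by rewrite ler_pdivrMr; lra.
rewrite /entfun; lra.
Qed.

(** With p = s^2 this is 2 s^2 ln (1 / s) <= s, that is, [ln_le_half] at 1 / s. *)
Lemma Nmul_ln_le_sqrt p : 0 < p -> - (p * ln p) <= Num.sqrt p.
Proof.
move=> p0; set s := Num.sqrt p; have s0 : 0 < s by rewrite sqrtr_gt0.
have -> : p = s ^+ 2 by rewrite sqr_sqrtr// ltW.
rewrite lnXn// -mulr_natr.
have := @ln_le_half s^-1; rewrite invr_gt0 => /(_ s0).
rewrite lnV ?posrE// => h.
have : (s ^+ 2 * 2) * - ln s <= (s ^+ 2 * 2) * (s^-1 / 2).
  by rewrite ler_pM2l// mulr_gt0// exprn_gt0.
have -> : (s ^+ 2 * 2) * (s^-1 / 2) = s by field; rewrite gt_eqF.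
lra.
Qed.

(* Tangent-line form of the convexity of [t |-> exp (2 sqrt t)] *)
Lemma sqr_le_expR phi K : 0 <= phi -> 2^-1 <= K ->
  phi ^+ 2 <= K ^+ 2 - K + K * expR (1 + 2 * phi - 2 * K).
Proof.
move=> phi0 K2; have K0 : 0 < K by lra.
(* For phi >= K, the lower bounds 1 + x and 1 + x^2 / 2 of exp x at x = 2 (phi - K) are added, using
   e >= 2. For phi <= K - 1 the term K^2 - K alone suffices. In between (K - phi)^2 <= K, and 1 + x
   <= exp x is enough. *)
have [h|h] := leP K phi.
  have /(expR_ge1Dxn 1%N) : 0 <= 2 * (phi - K) by lra.
  rewrite (_ : 2`!%:R = 2 :> R)// => h1.
  have h2 : 1 + 2 * (phi - K) <= expR (2 * (phi - K)) by exact: expR_ge1Dx.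
  have h3 : 1 + 1 <= expR 1 :> R by exact: expR_ge1Dx.
  have -> : 1 + 2 * phi - 2 * K = 1 + 2 * (phi - K) by lra.
  rewrite expRD.
  set E := expR (2 * (phi - K)) in h1 h2 *.
  have h4 : 2 * E <= expR 1 * E by rewrite ler_wpM2r ?expR_ge0//; lra.
  have h5 : 2 + 2 * (phi - K) + 2 * (phi - K) ^+ 2 <= expR 1 * E.
    by apply: le_trans h4; lra.
  have h6 : K * (2 + 2 * (phi - K) + 2 * (phi - K) ^+ 2) <= K * (expR 1 * E).
    by rewrite ler_pM2l.
  have h7 : (phi - K) ^+ 2 <= K * 2 * (phi - K) ^+ 2.
    by rewrite -[leLHS]mul1r ler_wpM2r ?sqr_ge0//; lra.
  nra.
have [h1|h1] := leP 1 (K - phi).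
  have : 0 <= K * expR (1 + 2 * phi - 2 * K) by rewrite mulr_ge0 ?expR_ge0 ?ltW.
  nra.
have : K * (1 + (1 + 2 * phi - 2 * K)) <= K * expR (1 + 2 * phi - 2 * K).
  by rewrite ler_pM2l// expR_ge1Dx.
nra.
Qed.

(** Fenchel duality between the entropy and the exponential: 1 + x <= exp x at x = s + ln k - ln u,
    times u. The scale [k] is left free for a later optimization. *)
Lemma young_entropy u s k : 0 < u -> 0 < k ->
  u * s <= u * ln u - u * ln k - u + k * expR s.
Proof.
move=> u0 k0; have := expR_ge1Dx (s + ln k - ln u).
rewrite expRB expRD !lnK ?posrE// => h.
have : u * (1 + (s + ln k - ln u)) <= u * (expR s * k / u) by rewrite ler_pM2l.
have -> : u * (expR s * k / u) = k * expR s by field; rewrite gt_eqF.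
lra.
Qed.

End real_inequalities.

(* For [r <= 5] this is AM-GM with [(r - 1)^2 <= 4 entfun r]; for [r > 5] it is
   Young's inequality for the entropy applied to [r - 1]. *)
Lemma weighted_pinsker_pointwise {R : realType} (phi r lam kap K : R) :
  0 <= phi -> 0 < r -> 0 < lam -> 0 < kap -> 2^-1 <= K ->
  phi * `|r - 1| <=
    lam / 2 * (K ^+ 2 - K)
    + (lam / 2 * K * expR (1 - 2 * K) + kap / 2) * expR (2 * phi)
    + (2 / lam + 3 / 4) * entfun r
    + (- ln kap - 1) / 2 * (if 5 < r then r - 1 else 0).
Proof.
move=> phi0 r0 lam0 kap0 K2.
have h0 := entfun_ge0 r (ltW r0).
have E0 := expR_gt0 (2 * phi).
have lamh0 : 0 <= 2 / lam * entfun r by rewrite mulr_ge0// divr_ge0// ltW.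
have kapE0 : 0 <= kap / 2 * expR (2 * phi) by rewrite mulr_ge0 ?divr_ge0 ?ltW.
have phi2 : lam / 2 * phi ^+ 2 <= lam / 2 * (K ^+ 2 - K)
    + lam / 2 * K * expR (1 - 2 * K) * expR (2 * phi).
  have l20 : 0 <= lam / 2 by rewrite divr_ge0 ?ltW.
  have := ler_wpM2l l20 (sqr_le_expR phi K phi0 K2).
  have -> : 1 + 2 * phi - 2 * K = 1 - 2 * K + 2 * phi by lra.
  by rewrite expRD mulrDr !mulrA.
have [r5|r5] := leP r 5.
  rewrite mulr0 addr0.
  have amgm : phi * `|r - 1| <= lam / 2 * phi ^+ 2 + (r - 1) ^+ 2 / (2 * lam).
    rewrite -(real_normK (num_real (r - 1))); set v := `|_|.
    rewrite -subr_ge0.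
    have -> : lam / 2 * phi ^+ 2 + v ^+ 2 / (2 * lam) - phi * v =
        (lam * phi - v) ^+ 2 / (2 * lam) by field; rewrite gt_eqF.
    by rewrite divr_ge0 ?sqr_ge0 ?mulr_ge0 ?ltW.
  have : (r - 1) ^+ 2 / (2 * lam) <= 2 / lam * entfun r.
    have -> : 2 / lam * entfun r = 4 * entfun r / (2 * lam).
      by field; rewrite gt_eqF.
    by rewrite ler_pM2r ?invr_gt0 ?mulr_gt0// sqr_le_entfun.
  move=> h; rewrite [(_ + kap / 2) * _]mulrDl [(2 / lam + _) * _]mulrDl; lra.
rewrite gtr0_norm; last by lra.
(* The terms carrying [lam] are only discarded here, but K^2 - K can be negative; combined with
   [phi2], this shows that their sum is nonnegative. *)
have lamphi0 : 0 <= lam / 2 * phi ^+ 2.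
  by rewrite mulr_ge0 ?sqr_ge0 ?divr_ge0 ?ltW.
(* Half of this inequality bounds phi (r - 1); half of the factor 3/2 in [mul_ln_le_entfun] is the
   coefficient 3/4. *)
have := young_entropy (r - 1) (2 * phi) kap ltac:(lra) kap0.
have := mul_ln_le_entfun (r - 1) ltac:(lra).
rewrite subrK [(_ + kap / 2) * _]mulrDl [(2 / lam + _) * _]mulrDl.
move: (ln kap) (ln (r - 1)) => lk lr h1 h2; lra.
Qed.

(** * The weighted Pinsker inequality with explicit constants *)

Section weighted_pinsker.
Context {R : realType} {d} {T : measurableType d} (mu : probability T R).

Lemma weighted_pinsker (phi r : T -> R) (H M : R) :
  measurable_fun setT phi -> measurable_fun setT r ->
  (forall x, 0 <= phi x) -> (forall x, 0 < r x) -> 0 < H ->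
  (\int[mu]_x (entfun (r x))%:E = H%:E)%E ->
  (\int[mu]_x (expR (2 * phi x))%:E = M%:E)%E ->
  (\int[mu]_x (phi x * `|r x - 1|)%:E <=
    ((3 / 2 + ln M) * (Num.sqrt H + H / 2))%:E)%E.
Proof.
move=> mphi mr phi0 r0 H0 HE ME.
have mE : measurable_fun setT (fun x => expR (2 * phi x)).
  by apply: measurableT_comp => //; exact: measurable_funM.
have mh : measurable_fun setT (fun x => entfun (r x)).
  apply: measurable_funD => //; apply: measurable_funB => //.
  by apply: measurable_funM => //; exact: measurableT_comp.
(* [U] is dominated by the entropy, so its integral [p] is at most [H]. *)
pose U x := if 5 < r x then r x - 1 else 0.
have U0 x : 0 <= U x by rewrite /U; case: ltP => // ?; lra.
have Uh x : U x <= entfun (r x).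
  rewrite /U; case: ltP => r5; first by apply: sub1_le_entfun; exact: ltW.
  by apply: entfun_ge0; exact: ltW.
have mU : measurable_fun setT U.
  apply: measurable_fun_ifT => //; first exact: measurable_fun_ltr.
  exact: measurable_funB.
have intE : mu.-integrable setT (EFin \o (fun x => expR (2 * phi x))).
  apply/integrableP; split; first exact/measurable_EFinP.
  under eq_integral do rewrite /= ger0_norm ?expR_ge0//.
  by rewrite ME ltry.
have inth : mu.-integrable setT (EFin \o (fun x => entfun (r x))).
  apply/integrableP; split; first exact/measurable_EFinP.
  under eq_integral do rewrite /= ger0_norm ?entfun_ge0 ?ltW//.
  by rewrite HE ltry.
have intU : mu.-integrable setT (EFin \o U).
  apply: le_integrable inth => //; first exact/measurable_EFinP.
  by move=> x _ /=; rewrite lee_fin ger0_norm// ger0_norm ?entfun_ge0// ltW.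
pose p := (\int[mu]_x U x)%R.
have p0 : 0 <= p by apply: Rintegral_ge0.
have pH : p <= H.
  have -> : H = (\int[mu]_x entfun (r x))%R by rewrite /Rintegral HE.
  by apply: le_Rintegral => // x _; exact: Uh.
have M1 : 1 <= M.
  rewrite -lee_fin -ME -(@probability_setT _ _ _ mu) -[leLHS]mul1e -integral_cst//.
  apply: ge0_le_integral => //; first exact: measurableT_comp.
  by move=> x _; rewrite lee_fin -expR0 ler_expR mulr_ge0.
have M0 : 0 < M by exact: lt_le_trans M1.
set L := ln M; have L0 : 0 <= L by exact: ln_ge0.
set s := Num.sqrt H; have s0 : 0 < s by rewrite sqrtr_gt0.
have sH : s ^+ 2 = H by rewrite sqr_sqrtr// ltW.
(* This makes exp (1 - 2K) equal to 1 / M, so that [sqr_le_expR] integrates to K^2 - K + K = K^2. *)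
pose K := (1 + L) / 2; have K2 : 2^-1 <= K by rewrite /K; lra.
have K0 : 0 < K by lra.
(* [lam] balances the two AM-GM terms once the second moment of [phi] is bounded
   by [K^2]; [kap] below is optimal for the entropic Young inequality. *)
pose lam := 2 * s / K; have lam0 : 0 < lam.
  by apply: divr_gt0 => //; exact: mulr_gt0.
have EK : expR (1 - 2 * K) = M^-1.
  rewrite (_ : 1 - 2 * K = - L); last by rewrite /K; lra.
  by rewrite expRN lnK ?posrE.
have main kap : 0 < kap -> (\int[mu]_x (phi x * `|r x - 1|)%:E <=
    (s * (1 + L) + 3 / 4 * H + (kap * M - p * ln kap - p) / 2)%:E)%E.
  move=> kap0.
  have [c0 c0E] : exists c0, c0 = lam / 2 * (K ^+ 2 - K) by eexists.
  pose g x := c0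
    + (lam / 2 * K * M^-1 + kap / 2) * expR (2 * phi x)
    + (2 / lam + 3 / 4) * entfun (r x)
    + (- ln kap - 1) / 2 * U x.
  have ge0g x : setT x -> (0 <= (phi x * `|r x - 1|)%:E)%E.
    by move=> _; rewrite lee_fin mulr_ge0.
  have leg x : phi x * `|r x - 1| <= g x.
    by rewrite /g c0E -EK; exact: weighted_pinsker_pointwise.
  have mg : measurable_fun setT g.
    apply: measurable_funD; last exact: measurable_funM.
    apply: measurable_funD; last exact: measurable_funM.
    by apply: measurable_funD => //; exact: measurable_funM.
  have mEg : measurable_fun setT (EFin \o g) by exact/measurable_EFinP.
  have int0 : mu.-integrable setT (EFin \o cst c0).
    exact: finite_measure_integrable_cst.
  have int1 := integrableZl measurableT (lam / 2 * K * M^-1 + kap / 2) intE.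
  have int2 := integrableZl measurableT (2 / lam + 3 / 4) inth.
  have int3 := integrableZl measurableT ((- ln kap - 1) / 2) intU.
  have int01 := integrableD measurableT int0 int1.
  have int012 := integrableD measurableT int01 int2.
  have int0123 := integrableD measurableT int012 int3.
  apply: (@le_trans _ _ (\int[mu]_x (g x)%:E)%E).
    apply: ge0_le_integral => //.
    - apply/measurable_EFinP; apply: measurable_funM => //.
      by apply: measurableT_comp => //; exact: measurable_funB.
    - by move=> x _; rewrite lee_fin.
  have -> : (\int[mu]_x (g x)%:E = (\int[mu]_x g x)%R%:E)%E.
    by rewrite /Rintegral fineK//; apply: integrable_fin_num.
  rewrite lee_fin /g RintegralD// RintegralD// RintegralD// !RintegralZl//.
  rewrite Rintegral_cst// -/p /Rintegral HE ME/= probability_setT/= mulr1.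
  rewrite -/(Rintegral _ _ _) -/p.
  rewrite le_eqVlt; apply/orP; left; apply/eqP.
  have LK : L = 2 * K - 1 by rewrite /K; lra.
  rewrite c0E LK -sH /lam; field.
  by rewrite !gt_eqF.
(* At kap = p / M the last term of [main] is (p L - p ln p) / 2 <= (H L + s) / 2, which brings the
   total to (3/2 + L) (s + H / 2). *)
have [p0'|p0'] := ltP 0 p.
  apply: le_trans (main (p / M) _) _; first by rewrite divr_gt0.
  rewrite lee_fin divfK ?gt_eqF// ln_div ?posrE//.
  have h1 := Nmul_ln_le_sqrt p p0'.
  have h2 : Num.sqrt p <= s by exact: ler_wsqrtr.
  have h3 : p * L <= H * L by rewrite ler_wpM2r.
  rewrite -/L; nra.
have pE : p = 0 by apply/eqP; rewrite eq_le p0 p0'.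
rewrite pE in main.
(* For p = 0 the previous choice of [kap] would not be positive; s / M contributes the same s /
   2. *)
apply: le_trans (main (s / M) _) _; first by rewrite divr_gt0.
rewrite lee_fin divfK ?gt_eqF// mul0r.
have : 0 <= L * H by rewrite mulr_ge0// ltW.
nra.
Qed.

End weighted_pinsker.

(** * Densities and formulas for the relative entropy *)

Section density.
Context {R : realType}.

(** A real-valued version, nonnegative everywhere, is fixed, so that densities can be multiplied and
    inverted pointwise rather than almost everywhere. *)
Definition has_density {d} {T : measurableType d} (rho sigma : probability T R)
    (z : T -> R) : Prop :=
  [/\ measurable_fun setT z, forall x, 0 <= z x &
    forall A, measurable A -> (rho A = \int[sigma]_(x in A) (z x)%:E)%E].

Context {d} {T : measurableType d}.
Implicit Types (rho sigma tau : probability T R) (z w : T -> R).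

Lemma has_density_dominates rho sigma z :
  has_density rho sigma z -> rho `<< sigma.
Proof.
move=> [mz z0 rhoE]; apply/null_content_dominatesP => A mA A0.
rewrite rhoE//; apply: null_set_integral => //.
by apply/measurable_EFinP; exact: measurable_funTS.
Qed.

Lemma has_density_integrable rho sigma z : has_density rho sigma z ->
  sigma.-integrable setT (EFin \o z).
Proof.
move=> [mz z0 rhoE]; apply/integrableP; split; first exact/measurable_EFinP.
under eq_integral do rewrite /= ger0_norm//.
by rewrite -rhoE// probability_setT ltry.
Qed.

Lemma has_density_ge0_integral rho sigma z (f : T -> \bar R) :
  has_density rho sigma z -> measurable_fun setT f -> (forall x, (0 <= f x)%E) ->
  (\int[rho]_x f x = \int[sigma]_x (f x * (z x)%:E))%E.
Proof.
move=> rhoz mf f0; have dom := has_density_dominates _ _ _ rhoz.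
have intz := has_density_integrable _ _ _ rhoz.
have [mz z0 rhoE] := rhoz.
have mEz : measurable_fun setT (fun x => (z x)%:E) by exact/measurable_EFinP.
have mRN := measurable_int _ (Radon_Nikodym_SigmaFinite.f_integrable dom).
rewrite -(Radon_Nikodym_SigmaFinite.change_of_variables dom f0 measurableT mf).
apply: ge0_ae_eq_integral => //.
- exact: emeasurable_funM.
- exact: emeasurable_funM.
- by move=> x _; rewrite mule_ge0// Radon_Nikodym_SigmaFinite.f_ge0.
- by move=> x _; rewrite mule_ge0 ?lee_fin.
- apply: ae_eqe_mul2l; apply: integral_ae_eq => //.
    exact: Radon_Nikodym_SigmaFinite.f_integrable.
  by move=> A _ mA;
    rewrite -(Radon_Nikodym_SigmaFinite.f_integral dom mA); exact: rhoE.
Qed.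

(** Treating positive and negative parts separately avoids any integrability assumption on [f]. *)
Lemma has_density_integral rho sigma z (f : T -> R) :
  has_density rho sigma z -> measurable_fun setT f ->
  (\int[rho]_x (f x)%:E = \int[sigma]_x (f x * z x)%:E)%E.
Proof.
move=> rhoz mf; have [mz z0 _] := rhoz.
have mEf : measurable_fun setT (EFin \o f) by exact/measurable_EFinP.
rewrite integralE [RHS]integralE; congr (_ - _)%E.
- rewrite (has_density_ge0_integral _ _ _ _ rhoz)//; last exact: measurable_funepos.
  apply: eq_integral => x _; rewrite !funeposE -!EFin_max -EFinM.
  by rewrite maxr_pMl ?mul0r.
- rewrite (has_density_ge0_integral _ _ _ _ rhoz)//; last exact: measurable_funeneg.
  apply: eq_integral => x _; rewrite !funenegE -!EFinN -!EFin_max -EFinM.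
  by rewrite maxr_pMl ?mul0r ?mulNr.
Qed.

Lemma has_density_trans rho sigma tau z w : has_density rho sigma z ->
  has_density sigma tau w -> has_density rho tau (fun x => z x * w x).
Proof.
move=> rhoz sigmaw; have [mz z0 rhoE] := rhoz; have [mw w0 sigmaE] := sigmaw.
split; [exact: measurable_funM|by move=> x; exact: mulr_ge0|move=> A mA].
rewrite rhoE// integral_mkcond [RHS]integral_mkcond.
rewrite (has_density_ge0_integral _ _ _ _ sigmaw); last 2 first.
- apply/(measurable_restrictT _ mA)/measurable_EFinP; exact: measurable_funTS.
- by move=> x; rewrite patchE; case: ifP => // _; rewrite lee_fin.
apply: eq_integral => x _; rewrite !patchE; case: ifP => // _.
by rewrite mul0e.
Qed.

Lemma has_density_inv rho sigma z : has_density rho sigma z ->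
  (forall x, 0 < z x) ->
  has_density sigma rho (fun x => (z x)^-1).
Proof.
move=> rhoz z0; have [mz _ rhoE] := rhoz.
have mzV : measurable_fun setT (fun x => (z x)^-1).
  have -> : (fun x => (z x)^-1) = (fun x => expR (- ln (z x))).
    by apply/funext => x; rewrite expRN lnK ?posrE.
  apply: measurableT_comp => //; apply: measurable_funN.
  exact: measurableT_comp.
split => // [x|A mA]; first by rewrite invr_ge0 ltW.
rewrite integral_mkcond (has_density_ge0_integral _ _ _ _ rhoz); last 2 first.
- apply/(measurable_restrictT _ mA)/measurable_EFinP; exact: measurable_funTS.
- by move=> x; rewrite patchE; case: ifP => // _; rewrite lee_fin invr_ge0 ltW.
rewrite -[LHS]mul1e -integral_cst// [LHS]integral_mkcond.
apply: eq_integral => x _; rewrite !patchE; case: ifP => // _.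
  by rewrite -EFinM mulVf// gt_eqF.
by rewrite mul0e.
Qed.

(** Both [z] and 1 have integral 1 against [sigma], so adding 1 - z to z ln z changes nothing and
    makes the integrand nonnegative. *)
Lemma relent_ge0_density rho sigma z : has_density rho sigma z ->
  relent rho sigma = (\int[sigma]_x (entfun (z x))%:E)%E.
Proof.
move=> rhoz; have [mz z0 rhoE] := rhoz.
have dom := has_density_dominates _ _ _ rhoz.
have mEz : measurable_fun setT (EFin \o z) by exact/measurable_EFinP.
have mlnz : measurable_fun setT (fun x => ln (z x)) by exact: measurableT_comp.
(* [lne] and [ln] differ at 0, with values -oo and 0; the zeros of [z] are negligible for [rho]. *)
have zpos : {ae rho, forall x, 0 < z x}.
  have mN : measurable [set x | z x <= 0].
    have := measurable_fun_ler mz (@measurable_cst _ _ T _ setT (0 : R)).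
    by move=> /(_ measurableT [set true]) /(_ I); rewrite setTI.
  exists [set x | z x <= 0]; split => //.
    rewrite rhoE//; apply: integral0_eq => x /= zx; congr EFin.
    by apply/eqP; rewrite eq_le zx z0.
  by move=> x /= /negP; rewrite -leNgt.
rewrite /relent; case: pselect => // dom'.
transitivity (\int[rho]_x (ln (z x))%:E)%E.
  apply: ae_eq_integral => //.
  - set f := Radon_Nikodym _ _.
    have mf : measurable_fun setT f.
      exact: (measurable_int _ (@Radon_Nikodym_integrable _ _ _
        (charge_of_finite_measure rho) sigma dom')).
    have -> : (fun x => lne (f x)) = (fun x =>
        if fine (f x) <= 0 then -oo%E else (ln (fine (f x)))%:E).
      apply/funext => x.
      by rewrite -{1}(@fineK _ (f x)) ?Radon_Nikodym_fin_num.
    have mfine : measurable_fun setT (fun x => fine (f x)).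
      exact: measurableT_comp.
    apply: measurable_fun_ifT => //; first exact: measurable_fun_ler.
    by apply/measurable_EFinP; exact: measurableT_comp.
  - exact/measurable_EFinP.
  - have : ae_eq sigma setT (Radon_Nikodym (charge_of_finite_measure rho) sigma)
        (EFin \o z).
      apply: integral_ae_eq => //; first exact: Radon_Nikodym_integrable.
      by move=> A _ mA; rewrite -Radon_Nikodym_integral//; exact: rhoE.
    (* Uniqueness of the density holds almost everywhere for [sigma], and passes to [rho] by
       domination. *)
    move=> RNz; have := null_dominates_ae_eq measurableT dom RNz.
    by apply: filterS2 zpos => x zx + _ => /(_ I) ->/=; rewrite leNgt zx.
rewrite (has_density_integral _ _ _ _ rhoz)//.
pose g x := ln (z x) * z x.
have mg : measurable_fun setT g by exact: measurable_funM.
have mEg : measurable_fun setT (EFin \o g) by exact/measurable_EFinP.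
have mgp := measurable_funepos mEg; have mgn := measurable_funeneg mEg.
have ment : measurable_fun setT (EFin \o (fun x => entfun (z x))).
  apply/measurable_EFinP; apply: measurable_funD => //.
  by apply: measurable_funB => //; exact: measurable_funM.
have ent0 x : setT x -> (0 <= (EFin \o (fun x => entfun (z x))) x)%E.
  by move=> _; rewrite lee_fin entfun_ge0.
have z0' x : setT x -> (0 <= (EFin \o z) x)%E by move=> _; rewrite lee_fin.
(* The identity z ln z + 1 = entfun z + z is arranged with nonnegative terms only, so both sides can
   be integrated term by term even if infinite. *)
have key : (\int[sigma]_x ((EFin \o g)^\+ x + cst 1 x) =
   \int[sigma]_x ((EFin \o (fun x => entfun (z x))) x + (EFin \o z) x
     + (EFin \o g)^\- x))%E.
  apply: eq_integral => x _.
  rewrite funeposE funenegE /= -!EFin_max -!EFinD -/(g x); congr EFin.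
  have -> : entfun (z x) = g x - z x + 1 by rewrite /entfun mulrC.
  have [g0|g0] := leP 0 (g x).
    have /max_idPr -> : - g x <= 0 by lra.
    lra.
  have /max_idPl -> : 0 <= - g x by lra.
  lra.
have int1 : (\int[sigma]_x cst 1 x = 1)%E.
  by rewrite integral_cst// mul1e; exact: probability_setT.
have intz : (\int[sigma]_x (EFin \o z) x = 1)%E.
  by rewrite -rhoE// probability_setT.
move: key; rewrite ge0_integralD// ge0_integralD//; last 2 first.
- by move=> x _; rewrite adde_ge0// ?ent0 ?z0'.
- exact: emeasurable_funD.
rewrite ge0_integralD// int1 intz.
(* The negative part is at most 1 because z ln z >= z - 1 >= -1; this allows its cancellation. *)
have negfin : (\int[sigma]_x (EFin \o g)^\- x)%E \is a fin_num.
  rewrite ge0_fin_numE; last by apply: integral_ge0.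
  rewrite (@le_lt_trans _ _ (\int[sigma]_x cst 1 x)%E)//; last by rewrite int1 ltry.
  apply: ge0_le_integral => //.
  move=> x _; rewrite funenegE /= -EFin_max lee_fin ge_max ler01 andbT.
  have := entfun_ge0 _ (z0 x); rewrite /entfun /g; have := z0 x; lra.
have -> : (\int[sigma]_x (ln (z x) * z x)%:E =
    \int[sigma]_x (EFin \o g)^\+ x - \int[sigma]_x (EFin \o g)^\- x)%E.
  exact: integralE.
have : (0 <= \int[sigma]_x (EFin \o (fun x => entfun (z x))) x)%E.
  exact: integral_ge0.
rewrite -[(\int[sigma]_x (entfun (z x))%:E)%E]/(\int[sigma]_x
  (EFin \o (fun x => entfun (z x))) x)%E.
move: negfin.
move: (\int[sigma]_x (EFin \o g)^\+ x)%E (\int[sigma]_x (EFin \o g)^\- x)%E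
  (\int[sigma]_x (EFin \o (fun x => entfun (z x))) x)%E.
move=> [p| |] [n| |] [h| |] //= _ _ [] pE.
by congr EFin; lra.
Qed.

(** Moved to [sigma], the second entropy has integrand z entfun (1 / z) = z - 1 - ln z; the linear
    terms cancel against those of entfun z. *)
Lemma jeffreys_density rho sigma z : has_density rho sigma z ->
  (forall x, 0 < z x) ->
  (relent rho sigma + relent sigma rho =
    \int[sigma]_x ((z x - 1) * ln (z x))%:E)%E.
Proof.
move=> rhoz z0; have [mz _ rhoE] := rhoz.
have rhozV := has_density_inv _ _ _ rhoz z0; have [mzV _ _] := rhozV.
have ment w : measurable_fun setT w -> measurable_fun setT (fun x : T => entfun (w x)).
  move=> mw; apply: measurable_funD => //.
  by apply: measurable_funB => //; apply: measurable_funM => //; exact: measurableT_comp.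
rewrite (relent_ge0_density _ _ _ rhoz).
rewrite (relent_ge0_density _ _ _ rhozV).
rewrite (has_density_integral _ _ _ _ rhoz); last exact: ment.
rewrite -ge0_integralD//.
- apply: eq_integral => x _; rewrite -EFinD; congr EFin.
  by rewrite /entfun lnV ?posrE//; field; rewrite gt_eqF.
- by move=> x _; rewrite lee_fin entfun_ge0 ?ltW.
- by apply/measurable_EFinP; exact: ment.
- by move=> x _; rewrite lee_fin mulr_ge0 ?entfun_ge0 ?invr_ge0 ?ltW.
- by apply/measurable_EFinP; apply: measurable_funM => //; exact: ment.
Qed.

Lemma relent_lty_dominates rho sigma : (relent rho sigma < +oo)%E -> rho `<< sigma.
Proof. by rewrite /relent; case: pselect. Qed.

Lemma exists_has_density rho sigma : rho `<< sigma ->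
  exists z, has_density rho sigma z.
Proof.
move=> dom; pose f := Radon_Nikodym_SigmaFinite.f rho sigma.
have mf : measurable_fun setT f.
  exact: (measurable_int _ (Radon_Nikodym_SigmaFinite.f_integrable dom)).
have ffin := Radon_Nikodym_SigmaFinite.f_fin_num dom.
exists (fun x => fine (f x)); split => [|x|A mA].
- exact: measurableT_comp.
- by apply: fine_ge0; exact: (Radon_Nikodym_SigmaFinite.f_ge0 dom).
- rewrite (Radon_Nikodym_SigmaFinite.f_integral dom mA).
  by apply: eq_integral => x _; rewrite fineK ?ffin.
Qed.

Lemma relent_ge0 rho sigma : (0 <= relent rho sigma)%E.
Proof.
have [dom|ndom] := pselect (rho `<< sigma); last by rewrite /relent; case: pselect.
have [z rhoz] := exists_has_density _ _ dom; rewrite (relent_ge0_density _ _ _ rhoz).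
by have [_ z0 _] := rhoz; apply: integral_ge0 => x _; rewrite lee_fin entfun_ge0.
Qed.

(** The zero set of a density of [rho] is null for [rho], hence for [sigma] by the reverse
    domination, so the density may be reset to 1 there. *)
Lemma exists_gt0_has_density rho sigma :
  (relent rho sigma < +oo)%E -> (relent sigma rho < +oo)%E ->
  exists2 z, has_density rho sigma z & forall x, 0 < z x.
Proof.
move=> /relent_lty_dominates dom /relent_lty_dominates domV.
have [F [mF F0 FE]] := exists_has_density _ _ dom.
pose z x := if F x <= 0 then 1 else F x.
have mz : measurable_fun setT z.
  by apply: measurable_fun_ifT => //; exact: measurable_fun_ler.
have z0 x : 0 < z x by rewrite /z; case: (leP (F x) 0).
exists z => //; split=> // [x|A mA]; first exact: ltW.
rewrite FE//; apply: ge0_ae_eq_integral => //.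
- by apply/measurable_EFinP; exact: measurable_funTS.
- by apply/measurable_EFinP; exact: measurable_funTS.
- by move=> x _; rewrite lee_fin.
- by move=> x _; rewrite lee_fin ltW.
have mN : measurable [set x | F x <= 0].
  have := measurable_fun_ler mF (@measurable_cst _ _ T _ setT (0 : R)).
  by move=> /(_ measurableT [set true]) /(_ I); rewrite setTI.
exists [set x | F x <= 0]; split => //.
- apply: ((null_content_dominatesP _ _).1 domV) => //.
  rewrite [LHS]FE//; apply: integral0_eq => x /= Fx; congr EFin.
  by apply/eqP; rewrite eq_le Fx F0.
- move=> x /= /not_implyP[_ /eqP]; rewrite /z.
  by case: ifPn => // _; rewrite eqxx.
Qed.

End density.

(** * The estimate for a single marginal *)

Section marginal.
Context {R : realType} {d} {T : measurableType d}.
Implicit Types (mu : probability T R) (f r : T -> R).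

Lemma integral_expR_ge1 mu f : measurable_fun setT f -> (forall x, 0 <= f x) ->
  (1 <= \int[mu]_x (expR (f x))%:E)%E.
Proof.
move=> mf f0; rewrite -(@probability_setT _ _ _ mu) -[leLHS]mul1e -integral_cst//.
apply: ge0_le_integral => //.
- by apply/measurable_EFinP; exact: measurableT_comp.
- by move=> x _; rewrite lee_fin -expR0 ler_expR.
Qed.

Lemma Cconst_ge0 mu f : measurable_fun setT f -> (0 <= Cconst mu f)%E.
Proof.
move=> mf; apply: le_ereal_inf_tmp => _ [a /= a0 <-].
apply: mule_ge0; first by rewrite lee_fin divr_ge0// ltW.
apply: adde_ge0; first by rewrite lee_fin divr_ge0.
rewrite lne_ge0 integral_expR_ge1//.
  by apply: measurable_funM => //; exact: measurableT_comp.
by move=> x; rewrite mulr_ge0// ltW.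
Qed.

(** For each [a], [weighted_pinsker] is applied to (a / 2) |f|, which turns its exponent 2 into [a]
    and produces the factor 2 / a. Dividing by the positive constant [k] first lets the infimum be
    taken. *)
Lemma weighted_pinsker_Cconst mu f r (H : R) :
  measurable_fun setT f -> measurable_fun setT r -> (forall x, 0 < r x) -> 0 < H ->
  (\int[mu]_x (entfun (r x))%:E = H%:E)%E ->
  (\int[mu]_x (`|f x| * `|r x - 1|)%:E <=
    Cconst mu f * (Num.sqrt H + H / 2)%:E)%E.
Proof.
move=> mf mr r0 H0 HE; set k := Num.sqrt H + H / 2.
have k0 : 0 < k by rewrite addr_gt0 ?sqrtr_gt0 ?divr_gt0.
rewrite -lee_pdivrMr//; apply: le_ereal_inf_tmp => _ [a /= a0 <-].
rewrite lee_pdivrMr//.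
have maf : measurable_fun setT (fun x => a / 2 * `|f x|).
  by apply: measurable_funM => //; exact: measurableT_comp.
have maf' : measurable_fun setT (fun x => a * `|f x|).
  by apply: measurable_funM => //; exact: measurableT_comp.
have af0 x : 0 <= a * `|f x| by rewrite mulr_ge0// ltW.
have := integral_expR_ge1 mu _ maf' af0.
case ME : (\int[mu]_x (expR (a * `|f x|))%:E)%E => [M| |]//; last first.
  (* An infinite exponential moment makes the right-hand side infinite. *)
  move=> _ /=; rewrite addey// gt0_muley ?lte_fin ?divr_gt0// gt0_mulye ?lte_fin//.
  by rewrite leey.
rewrite lee_fin => M1; rewrite lne_EFin; last exact: lt_le_trans M1.
have af20 x : 0 <= a / 2 * `|f x| by rewrite mulr_ge0// divr_ge0// ltW.
have ME' : (\int[mu]_x (expR (2 * (a / 2 * `|f x|)))%:E = M%:E)%E.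
  by rewrite -ME; apply: eq_integral => x _; congr (expR _)%:E; field.
have := weighted_pinsker mu _ _ _ _ maf mr af20 r0 H0 HE ME'.
have -> : (\int[mu]_x (a / 2 * `|f x| * `|r x - 1|)%:E =
    (a / 2)%:E * \int[mu]_x (`|f x| * `|r x - 1|)%:E)%E.
  under eq_integral do rewrite -mulrA EFinM.
  rewrite ge0_integralZl_EFin//.
  - apply/measurable_EFinP; apply: measurable_funM; first exact: measurableT_comp.
    by apply: measurableT_comp => //; exact: measurable_funB.
  - by rewrite divr_ge0// ltW.
rewrite -/k => h.
have a20 : 0 < 2 / a by rewrite divr_gt0.
have := lee_wpmul2l _ h => /(_ (2 / a)%:E); rewrite lee_fin (ltW a20) => /(_ isT).
rewrite muleA -EFinM (_ : 2 / a * (a / 2) = 1); last by field; rewrite gt_eqF.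
by rewrite mul1e -EFinD -!EFinM mulrA.
Qed.

Lemma entfun_eq0 (x : R) : 0 < x -> entfun x = 0 -> x = 1.
Proof.
move=> x0 e0; have [x5|x5] := leP x 5.
  have := sqr_le_entfun _ x0 x5; rewrite e0 mulr0 => h.
  have /eqP : (x - 1) ^+ 2 == 0 by rewrite eq_le h sqr_ge0.
  by move/eqP; rewrite sqrf_eq0 subr_eq0 => /eqP.
by have := sub1_le_entfun _ (ltW x5); rewrite e0; lra.
Qed.

(** |t| <= |f| + |ln r| splits the integral in two: the weighted Pinsker inequality handles |f| |r -
    1|, and (r - 1) ln r integrates to the sum of both entropies. *)
Lemma marginal_bound (mu mu' : probability T R) f r (t : T -> R) (N : R) :
  has_density mu' mu r -> (forall x, 0 < r x) ->
  measurable_fun setT f -> measurable_fun setT t ->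
  (forall x, `|t x| <= N) -> (forall x, `|t x| <= `|f x + ln (r x)|) ->
  (relent mu' mu < +oo)%E ->
  (\int[mu]_x ((r x - 1) * t x)%:E <=
    Cconst mu f * sqrte (relent mu' mu)
    + (1 + Cconst mu f * (2^-1)%:E) * relent mu' mu + relent mu mu')%E.
Proof.
move=> rdens r0 mf mt tN tF Hfin; have [mr _ _] := rdens.
have HE := relent_ge0_density _ _ _ rdens.
have C0 := Cconst_ge0 mu f mf.
have mr1 : measurable_fun setT (fun x => r x - 1) by exact: measurable_funB.
have mlnr : measurable_fun setT (fun x => ln (r x)) by exact: measurableT_comp.
have ment : measurable_fun setT (fun x => entfun (r x)).
  apply: measurable_funD => //; apply: measurable_funB => //.
  exact: measurable_funM.
have mrt : measurable_fun setT (fun x => ((r x - 1) * t x)%:E).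
  by apply/measurable_EFinP; exact: measurable_funM.
(* Zero entropy is treated apart: [Cconst] may be infinite, and its product with 0 is 0, so the
   left-hand integral has to vanish. It does, since r = 1 almost everywhere. *)
have [H00|H0n] := eqVneq (relent mu' mu) 0%E.
  rewrite (_ : (\int[mu]_x _ = 0)%E).
    by rewrite H00 sqrte0 !mule0 !add0e relent_ge0.
  have r1 : ae_eq mu setT (EFin \o (fun x => entfun (r x))) (cst 0%E).
    apply/ae_eq_integral_abs => //; first exact/measurable_EFinP.
    rewrite -H00 HE; apply: eq_integral => x _.
    by rewrite /= ger0_norm// entfun_ge0// ltW.
  rewrite -(integral0 mu setT); apply: ae_eq_integral => //.
  apply: filterS r1 => x /[swap] _ /(_ I) /= [] /(entfun_eq0 _ (r0 x)) ->.
  by rewrite subrr mul0r.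
have HP : (0 < relent mu' mu)%E by rewrite lt_neqAle eq_sym H0n relent_ge0.
case hE : (relent mu' mu) HP Hfin HE => [h| |]// h0 _ HE.
rewrite lte_fin in h0.
have W := weighted_pinsker_Cconst mu f r h mf mr r0 h0 (esym HE).
have J := jeffreys_density _ _ _ rdens r0.
have mfr : measurable_fun setT (fun x => (`|f x| * `|r x - 1|)%:E).
  by apply/measurable_EFinP; apply: measurable_funM; exact: measurableT_comp.
have mln : measurable_fun setT (fun x => ((r x - 1) * ln (r x))%:E).
  by apply/measurable_EFinP; exact: measurable_funM.
have ln0 x : 0 <= (r x - 1) * ln (r x).
  have [r1|r1] := leP 1 (r x); first by rewrite mulr_ge0 ?subr_ge0 ?ln_ge0.
  by rewrite mulr_le0 ?subr_le0 ?ln_le0// ltW.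
have fr0 x : 0 <= `|f x| * `|r x - 1| by rewrite mulr_ge0.
apply: (@le_trans _ _ (\int[mu]_x ((`|f x| * `|r x - 1|)%:E
    + ((r x - 1) * ln (r x))%:E))%E).
  apply: (@le_trans _ _ (\int[mu]_x `| ((r x - 1) * t x)%:E |)%E).
    apply: le_trans (le_abse_integral _ _ _) => //; exact: lee_abs.
  apply: ge0_le_integral => //.
  - by apply: measurableT_comp.
  - by apply: emeasurable_funD.
  - move=> x _; rewrite -EFinD lee_fin normrM mulrC.
    rewrite -[X in _ <= _ + X]ger0_norm// normrM [X in _ <= _ + X]mulrC -mulrDl.
    by rewrite ler_wpM2r// (le_trans (tF x))// ler_normD.
rewrite ge0_integralD//; last by move=> x _; rewrite lee_fin.
rewrite -J hE addeA leeD2r//.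
apply: (@le_trans _ _ (Cconst mu f * (Num.sqrt h + h / 2)%:E + h%:E)%E).
  by rewrite leeD2r.
(* For finite C this regroups C (sqrt h + h / 2) + h; for infinite C both sides are +oo because h >
   0. *)
case CE : (Cconst mu f) C0 => [C| |]// _.
  by rewrite /= -!EFinM -!EFinD lee_fin; lra.
rewrite /= !gt0_mulye ?lte_fin ?sqrtr_gt0 ?invr_gt0//.
by rewrite addr_gt0 ?sqrtr_gt0 ?divr_gt0.
Qed.

End marginal.

(** Tonelli: a product measure integrates the measures of sections, to which the density [s] applies
    for fixed x, and then [r]. *)
Lemma has_density_prodP {R : realType} {d1 d2} {X : measurableType d1}
    {Y : measurableType d2} (mu mu' : probability X R) (nu nu' : probability Y R)
    (r : X -> R) (s : Y -> R) :
  has_density mu' mu r -> has_density nu' nu s ->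
  has_density (prodP mu' nu') (prodP mu nu) (fun z => r z.1 * s z.2).
Proof.
move=> rdens sdens; have [mr r0 _] := rdens; have [ms s0 sE] := sdens.
have mrs : measurable_fun setT (fun z : X * Y => r z.1 * s z.2).
  by apply: measurable_funM; exact: measurableT_comp.
split => // [z|A mA]; first by rewrite mulr_ge0.
rewrite integral_mkcond.
have mrsA : measurable_fun setT ((fun z : X * Y => (r z.1 * s z.2)%:E) \_ A).
  apply/(measurable_restrictT _ mA)/measurable_EFinP; exact: measurable_funTS.
have -> : (\int[prodP mu nu]_z ((fun z => (r z.1 * s z.2)%:E) \_ A) z =
   \int[mu]_x \int[nu]_y ((fun z : X * Y => (r z.1 * s z.2)%:E) \_ A) (x, y))%E.
  apply: fubini_tonelli1 => // z; rewrite patchE; case: ifP => // _.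
  by rewrite lee_fin mulr_ge0.
transitivity (\int[mu']_x nu' (xsection A x))%E; first by [].
rewrite (has_density_ge0_integral _ _ _ _ rdens) => //; last first.
  exact: measurable_fun_xsection.
apply: eq_integral => x _.
rewrite sE; last exact: measurable_xsection.
rewrite integral_mkcond muleC -ge0_integralZl_EFin//; last 2 first.
- by move=> y _; rewrite patchE; case: ifP => // _; rewrite lee_fin.
- apply/(measurable_restrictT _ (measurable_xsection _ mA))/measurable_EFinP.
  exact: measurable_funTS.
apply: eq_integral => y _; rewrite !patchE mem_xsection.
by case: ifP => _; rewrite ?mule0 -?EFinM.
Qed.

(** * Truncation of real functions *)

Section clamp.
Context {R : realType}.
Implicit Types (n : nat) (a b x : R).

Definition clamp n x : R := Num.max (- n%:R) (Num.min x n%:R).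

Lemma clampP n x : [\/ clamp n x = x /\ - n%:R <= x <= n%:R,
  clamp n x = - n%:R /\ x < - n%:R | clamp n x = n%:R /\ n%:R < x].
Proof.
have n0 : 0 <= n%:R :> R by [].
rewrite /clamp; have [xn|xn] := leP x n%:R.
  have [nx|nx] := leP (- n%:R) x; first by constructor 1; split => //; exact/andP.
  by constructor 2.
by constructor 3; split => //; apply/max_idPr; lra.
Qed.

Lemma clamp_bounded n x : `|clamp n x| <= n%:R.
Proof.
have n0 : 0 <= n%:R :> R by [].
by rewrite ler_norml; case: (clampP n x) => -[-> ?]; lra.
Qed.

Lemma clamp_le_norm n x : `|clamp n x| <= `|x|.
Proof.
have n0 : 0 <= n%:R :> R by [].
case: (clampP n x) => -[-> xn] //.
  by rewrite !ler0_norm; lra.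
by rewrite !ger0_norm; lra.
Qed.

Lemma clamp_id n x : `|x| <= n%:R -> clamp n x = x.
Proof.
by rewrite ler_norml => /andP[h1 h2]; rewrite /clamp (min_idPl h2) (max_idPr h1).
Qed.

(* [clamp n] is odd and nondecreasing, so [a >= - b] implies
   [clamp n a >= - clamp n b]. *)
Lemma clamp_add_ge0 n a b : 0 <= a + b -> 0 <= clamp n a + clamp n b.
Proof.
have n0 : 0 <= n%:R :> R by [].
by case: (clampP n a) => -[-> ?]; case: (clampP n b) => -[-> ?]; lra.
Qed.

Lemma clamp_add_le0 n a b : a + b <= 0 -> clamp n a + clamp n b <= 0.
Proof.
have n0 : 0 <= n%:R :> R by [].
by case: (clampP n a) => -[-> ?]; case: (clampP n b) => -[-> ?]; lra.
Qed.

(** z - 1 has the sign of ln z = a + b, and clamping both summands preserves that sign. This is the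
    nonnegativity required by Fatou's lemma. *)
Lemma subr1_clamp_ge0 n z a b : 0 < z -> ln z = a + b ->
  0 <= (z - 1) * (clamp n a + clamp n b).
Proof.
move=> z0 zab; have [z1|z1] := leP 1 z.
  by rewrite mulr_ge0 ?subr_ge0// clamp_add_ge0// -zab ln_ge0.
by rewrite mulr_le0 ?subr_le0 ?(ltW z1)// clamp_add_le0// -zab ln_le0// ltW.
Qed.

Lemma measurable_clamp {d} {T : measurableType d} n (f : T -> R) :
  measurable_fun setT f -> measurable_fun setT (fun t => clamp n (f t)).
Proof. by move=> mf; apply: measurable_maxr => //; exact: measurable_minr. Qed.

End clamp.

(** * Bounded integrands under a change of density or a projection *)

Section coupling.
Context {R : realType} {d} {T : measurableType d}.
Implicit Types (rho sigma : probability T R).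

Lemma bounded_integrable rho (f : T -> R) (N : R) : measurable_fun setT f ->
  (forall x, `|f x| <= N) -> rho.-integrable setT (EFin \o f).
Proof.
move=> mf fN; apply: (@le_integrable _ _ _ _ _ measurableT _ (cst N%:E)).
- exact/measurable_EFinP.
- by move=> x _ /=; rewrite lee_fin (le_trans (fN x))// ler_norm.
- exact: finite_measure_integrable_cst.
Qed.

(** Boundedness of [f] makes both integrals finite, so their difference is meaningful. *)
Lemma has_density_diff_integral rho sigma z (f : T -> R) (N : R) :
  has_density rho sigma z -> measurable_fun setT f -> (forall x, `|f x| <= N) ->
  sigma.-integrable setT (EFin \o (fun x => (z x - 1) * f x)) /\
  (\int[sigma]_x ((z x - 1) * f x)%:E =
   \int[rho]_x (f x)%:E - \int[sigma]_x (f x)%:E)%E.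
Proof.
move=> zdens mf fN; have [mz z0 _] := zdens.
have intf := bounded_integrable sigma f N mf fN.
have intz := has_density_integrable _ _ _ zdens.
have intfz : sigma.-integrable setT (EFin \o (fun x => f x * z x)).
  apply: (@le_integrable _ _ _ _ _ measurableT _ (fun x => N%:E * (EFin \o z) x)%E).
  - by apply/measurable_EFinP; exact: measurable_funM.
  - move=> x _ /=; rewrite lee_fin !normrM ler_wpM2r//.
    by rewrite (le_trans (fN x))// ler_norm.
  - exact: integrableZl.
have E : (EFin \o (fun x => (z x - 1) * f x)) =
    ((EFin \o (fun x => (f x * z x)%R)) \- (EFin \o f))%E.
  by apply/funext => x /=; rewrite -EFinB; congr EFin; lra.
split; first by rewrite E; exact: integrableB.
rewrite (has_density_integral _ _ _ _ zdens)//.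
transitivity (\int[sigma]_x ((EFin \o (fun x => (f x * z x)%R)) \- (EFin \o f)) x)%E.
  by rewrite -E.
by rewrite integralB.
Qed.

Lemma integral_marginal {d'} {U : measurableType d'} (p : T -> U)
    (pi : probability T R) (mu : probability U R) (f : U -> R) (N : R) :
  measurable_fun setT p ->
  (forall A, measurable A -> pi (p @^-1` A) = mu A) ->
  measurable_fun setT f -> (forall x, `|f x| <= N) ->
  (\int[pi]_x (f (p x))%:E = \int[mu]_y (f y)%:E)%E.
Proof.
move=> mp piE mf fN.
have mEf : measurable_fun setT (EFin \o f) by exact/measurable_EFinP.
have intfp : pi.-integrable (p @^-1` setT) ((EFin \o f) \o p).
  apply: (bounded_integrable pi (f \o p) N) => [|x]; last exact: fN.
  exact: measurableT_comp.
have <- := integral_pushforward mp mEf intfp measurableT.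
by apply: eq_measure_integral => A mA _; exact: piE.
Qed.

End coupling.

(** * Symmetrized entropy of couplings whose log-density is a sum of functions of one variable *)

Section relent_coupling.
Context {R : realType} {d1 d2} {X : measurableType d1} {Y : measurableType d2}.
Variables (mu mu' : probability X R) (nu nu' : probability Y R).
Variables (pi pi' : probability (X * Y)%type R).
Hypotheses (Hpi : is_coupling mu nu pi) (Hpi' : is_coupling mu' nu' pi').
Variables (r : X -> R) (s : Y -> R) (z : X * Y -> R) (F : X -> R) (G : Y -> R).
Hypotheses (rdens : has_density mu' mu r) (sdens : has_density nu' nu s).
Hypotheses (zdens : has_density pi' pi z) (z0 : forall w, 0 < z w).
Hypotheses (lnz : forall w, ln (z w) = F w.1 + G w.2).
Hypotheses (mF : measurable_fun setT F) (mG : measurable_fun setT G).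

Let integral_fst (rho : probability (X * Y)%type R) (m : probability X R)
    (n : probability Y R) (f : X -> R) N :
  is_coupling m n rho -> measurable_fun setT f -> (forall x, `|f x| <= N) ->
  (\int[rho]_w (f w.1)%:E = \int[m]_x (f x)%:E)%E.
Proof.
move=> [rhom _] mf fN; apply: (integral_marginal fst rho m f N) => // A mA.
by rewrite -rhom//; congr (rho _); apply/seteqP; split => -[x y]//= [].
Qed.

Let integral_snd (rho : probability (X * Y)%type R) (m : probability X R)
    (n : probability Y R) (f : Y -> R) N :
  is_coupling m n rho -> measurable_fun setT f -> (forall x, `|f x| <= N) ->
  (\int[rho]_w (f w.2)%:E = \int[n]_x (f x)%:E)%E.
Proof.
move=> [_ rhon] mf fN; apply: (integral_marginal snd rho n f N) => // A mA.
by rewrite -rhon//; congr (rho _); apply/seteqP; split => -[x y]//= [].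
Qed.

(** Integrating against z - 1 is integrating against pi' - pi. Each clamped term is bounded and
    depends on one coordinate, so only the marginals matter, and their densities are r and s. *)
Lemma integral_clamp k :
  (\int[pi]_w ((z w - 1) * (clamp k (F w.1) + clamp k (G w.2)))%:E =
   \int[mu]_x ((r x - 1) * clamp k (F x))%:E +
   \int[nu]_y ((s y - 1) * clamp k (G y))%:E)%E.
Proof.
have mcF := measurable_clamp k F mF; have mcG := measurable_clamp k G mG.
have bF x := clamp_bounded k (F x); have bG y := clamp_bounded k (G y).
have mcF1 : measurable_fun setT (fun w : X * Y => clamp k (F w.1)).
  exact: (measurableT_comp mcF measurable_fst).
have mcG2 : measurable_fun setT (fun w : X * Y => clamp k (G w.2)).
  exact: (measurableT_comp mcG measurable_snd).
have [i1 e1] := has_density_diff_integral _ _ _ _ _ zdens mcF1 (fun w => bF w.1).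
have [i2 e2] := has_density_diff_integral _ _ _ _ _ zdens mcG2 (fun w => bG w.2).
have [_ e3] := has_density_diff_integral _ _ _ _ _ rdens mcF bF.
have [_ e4] := has_density_diff_integral _ _ _ _ _ sdens mcG bG.
rewrite e3 e4 -(integral_fst _ _ _ _ _ Hpi mcF bF) -(integral_fst _ _ _ _ _ Hpi' mcF bF).
rewrite -(integral_snd _ _ _ _ _ Hpi mcG bG) -(integral_snd _ _ _ _ _ Hpi' mcG bG).
rewrite -e1 -e2 -[RHS]integralD_EFin//.
by apply: eq_integral => w _ /=; rewrite mulrDr.
Qed.

Lemma relent_coupling_le (BX BY : \bar R) :
  (forall k, \int[mu]_x ((r x - 1) * clamp k (F x))%:E <= BX)%E ->
  (forall k, \int[nu]_y ((s y - 1) * clamp k (G y))%:E <= BY)%E ->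
  (relent pi' pi + relent pi pi' <= BX + BY)%E.
Proof.
move=> leBX leBY; rewrite (jeffreys_density _ _ _ zdens z0).
have [mz _ _] := zdens.
pose g k w := ((z w - 1) * (clamp k (F w.1) + clamp k (G w.2)))%:E.
have mg k : measurable_fun setT (g k).
  apply/measurable_EFinP; apply: measurable_funM; first exact: measurable_funB.
  apply: measurable_funD.
    exact: (measurableT_comp (measurable_clamp k F mF) measurable_fst).
  exact: (measurableT_comp (measurable_clamp k G mG) measurable_snd).
have g0 k w : setT w -> (0 <= g k w)%E.
  by move=> _; rewrite lee_fin subr1_clamp_ge0.
(* Once k exceeds |F| and |G| at [w], no clamp is active and the sequence is constant. *)
have gcvg w : limn_einf (g ^~ w) = ((z w - 1) * ln (z w))%:E.
  apply: (cvg_limn_einf_sup _).1; apply: cvg_near_cst; near=> k.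
  have Fk : `|F w.1| <= k%:R by near: k; exact: nbhs_infty_ger.
  have Gk : `|G w.2| <= k%:R by near: k; exact: nbhs_infty_ger.
  by rewrite /g !clamp_id// -lnz.
have := fatou pi measurableT mg g0.
under eq_integral do rewrite gcvg.
(* The lower limit is a limit of infima over tails, each at most its first term, so a bound uniform
   in k is enough. *)
move=> /le_trans; apply; rewrite limn_einf_lim; apply: lime_le.
  exact: is_cvg_einfs.
apply: nearW => k; apply: (@le_trans _ _ (\int[pi]_w g k w)%E).
  by apply: ereal_inf_lbound; exists k => /=.
by rewrite integral_clamp leeD.
Unshelve. all: end_near. Qed.

End relent_coupling.

(** * Sign and infinite values of the upper bound *)

Section marginal_terms.
Context {R : realType}.
Local Open Scope ereal_scope.

(* As [0 * +oo = 0] and [+oo + -oo = -oo], so nonnegativity of all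
   the terms is what makes the sum infinite here. *)
Lemma marginal_terms_pinfty {d} {T : measurableType d}
    (mu mu' : probability T R) (C : \bar R) :
  0 <= C -> ~~ ((relent mu' mu < +oo) && (relent mu mu' < +oo)) ->
  C * sqrte (relent mu' mu) + (1 + C * (2^-1)%:E) * relent mu' mu
    + relent mu mu' = +oo.
Proof.
move=> C0; have C1 : 0 < 1 + C * (2^-1)%:E.
  by rewrite (@lt_le_trans _ _ 1)// leeDl// mule_ge0.
have Cs : 0 <= C * sqrte (relent mu' mu) by rewrite mule_ge0 ?sqrte_ge0.
have CH : 0 <= (1 + C * (2^-1)%:E) * relent mu' mu.
  by rewrite mule_ge0 ?relent_ge0// ltW.
rewrite negb_and -!leNgt !leye_eq => /orP[/eqP H|/eqP ->]; last first.
  by rewrite addey// gt_eqF// (lt_le_trans ltNy0)// adde_ge0.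
rewrite H in Cs CH *; rewrite (gt0_muley C1) addey; last first.
  by rewrite gt_eqF// (lt_le_trans ltNy0).
by rewrite addye// gt_eqF// (lt_le_trans ltNy0)// relent_ge0.
Qed.

Lemma marginal_terms_ge0 {d} {T : measurableType d}
    (mu mu' : probability T R) (C : \bar R) :
  0 <= C -> 0 <= C * sqrte (relent mu' mu)
    + (1 + C * (2^-1)%:E) * relent mu' mu + relent mu mu'.
Proof.
move=> C0; rewrite !adde_ge0 ?relent_ge0// mule_ge0 ?sqrte_ge0 ?relent_ge0//.
by rewrite adde_ge0// mule_ge0.
Qed.

End marginal_terms.

(** * Stability of optimal couplings in the marginals *)

Theorem theorem3p3 (R : realType) (dx dy : measure_display)
    (X : measurableType dx) (Y : measurableType dy)
    (HX : polish_borel R X) (HY : polish_borel R Y)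
    (c : X * Y -> R) (mc : measurable_fun setT c)
    (mu mu' : probability X R) (nu nu' : probability Y R)
    (Hc : (prodP mu nu).-integrable setT (fun z => (expR (- c z))%:E))
    (Hc' : (prodP mu' nu').-integrable setT (fun z => (expR (- c z))%:E))
    (Hfin : eot c mu nu \is a fin_num) (Hfin' : eot c mu' nu' \is a fin_num)
    (pi pi' : probability (X * Y)%type R)
    (Hpi : is_coupling mu nu pi) (Hopt : eot_obj c mu nu pi = eot c mu nu)
    (Hpi' : is_coupling mu' nu' pi') (Hopt' : eot_obj c mu' nu' pi' = eot c mu' nu')
    (phi phi' : X -> R) (psi psi' : Y -> R)
    (mphi : measurable_fun setT phi) (mphi' : measurable_fun setT phi')
    (mpsi : measurable_fun setT psi) (mpsi' : measurable_fun setT psi')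
    (Hdens : forall A, measurable A ->
       pi A = (\int[prodP mu nu]_(z in A) (expR (phi z.1 + psi z.2 - c z))%:E)%E)
    (Hdens' : forall A, measurable A ->
       pi' A = (\int[prodP mu' nu']_(z in A) (expR (phi' z.1 + psi' z.2 - c z))%:E)%E) :
  let C1 := Cconst mu (fun x => phi' x - phi x) in
  let C2 := Cconst nu (fun y => psi' y - psi y) in
  (relent pi' pi + relent pi pi' <=
     C1 * sqrte (relent mu' mu) + (1 + C1 * (2^-1)%:E) * relent mu' mu
       + relent mu mu'
     + C2 * sqrte (relent nu' nu) + (1 + C2 * (2^-1)%:E) * relent nu' nu
       + relent nu nu')%E.
Proof.
cbv zeta; set C1 := Cconst mu _; set C2 := Cconst nu _.
have mf : measurable_fun setT (fun x => phi' x - phi x) by exact: measurable_funB.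
have mg : measurable_fun setT (fun y => psi' y - psi y) by exact: measurable_funB.
have C10 : (0 <= C1)%E by exact: Cconst_ge0.
have C20 : (0 <= C2)%E by exact: Cconst_ge0.
set BX := (C1 * sqrte (relent mu' mu) + (1 + C1 * (2^-1)%:E) * relent mu' mu
  + relent mu mu')%E.
set BY := (C2 * sqrte (relent nu' nu) + (1 + C2 * (2^-1)%:E) * relent nu' nu
  + relent nu nu')%E.
have BX0 : (0 <= BX)%E by exact: marginal_terms_ge0.
have BY0 : (0 <= BY)%E by exact: marginal_terms_ge0.
have -> : (BX + C2 * sqrte (relent nu' nu) + (1 + C2 * (2^-1)%:E) * relent nu' nu
  + relent nu nu' = BX + BY)%E by rewrite /BY !addeA.
(* If one of the four marginal entropies is infinite, so is the right-hand side. Otherwise the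
   marginals are mutually absolutely continuous and have positive densities. *)
have [/andP[Hmu' Hmu]|] := boolP ((relent mu' mu < +oo) && (relent mu mu' < +oo))%E;
  last first.
  move=> Hmu; rewrite /BX marginal_terms_pinfty// addye ?leey//.
  by rewrite gt_eqF// (lt_le_trans ltNy0).
have [/andP[Hnu' Hnu]|] := boolP ((relent nu' nu < +oo) && (relent nu nu' < +oo))%E;
  last first.
  move=> Hnu; rewrite /BY marginal_terms_pinfty// addey ?leey//.
  by rewrite gt_eqF// (lt_le_trans ltNy0).
have [r rdens r0] := exists_gt0_has_density _ _ Hmu' Hmu.
have [s sdens s0] := exists_gt0_has_density _ _ Hnu' Hnu.
have [mr _ _] := rdens; have [ms _ _] := sdens.
have mexp (p : X -> R) (q : Y -> R) : measurable_fun setT p ->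
    measurable_fun setT q ->
    measurable_fun setT (fun z : X * Y => expR (p z.1 + q z.2 - c z)).
  move=> mp mq; apply: measurableT_comp => //; apply: measurable_funB => //.
  by apply: measurable_funD; exact: measurableT_comp.
pose e0 z := expR (phi z.1 + psi z.2 - c z).
pose e1 z := expR (phi' z.1 + psi' z.2 - c z).
have dens0 : has_density pi (prodP mu nu) e0.
  by split; [exact: mexp|move=> z; exact: expR_ge0|exact: Hdens].
have dens1 : has_density pi' (prodP mu' nu') e1.
  by split; [exact: mexp|move=> z; exact: expR_ge0|exact: Hdens'].
(* The density of pi' with respect to pi is composed along pi', mu' x nu', mu x nu, pi; the cost [c]
   cancels in its logarithm. *)
have zdens := has_density_trans _ _ _ _ _ (has_density_trans _ _ _ _ _ dens1
  (has_density_prodP mu mu' nu nu' r s rdens sdens))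
  (has_density_inv _ _ _ dens0 (fun z => expR_gt0 _)).
set z := (fun w => _) in zdens.
have z0 w : 0 < z w by rewrite /z !mulr_gt0 ?invr_gt0 ?expR_gt0.
pose F x := phi' x - phi x + ln (r x); pose G y := psi' y - psi y + ln (s y).
have mF : measurable_fun setT F by apply: measurable_funD => //; exact: measurableT_comp.
have mG : measurable_fun setT G by apply: measurable_funD => //; exact: measurableT_comp.
have lnz w : ln (z w) = F w.1 + G w.2.
  rewrite /z !lnM ?lnV ?posrE ?mulr_gt0 ?invr_gt0 ?expR_gt0// !expRK /F /G.
  lra.
apply: (relent_coupling_le _ _ _ _ _ _ Hpi Hpi' _ _ _ _ _ rdens sdens zdens z0 lnz mF mG) => k.
- apply: marginal_bound rdens r0 mf (measurable_clamp _ _ mF) _ _ Hmu' => x.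
    exact: clamp_bounded.
  exact: clamp_le_norm.
- apply: marginal_bound sdens s0 mg (measurable_clamp _ _ mG) _ _ Hnu' => x.
    exact: clamp_bounded.
  exact: clamp_le_norm.
Qed.
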